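(* Let $G$ be a necklace. If $G$ is not a cycle, then $G$ is of class $1^\pm$.
   Context: A necklace is a finite simple connected graph whose edge set can be decomposed into $k\geq2$ paths (each with at least one edge) all of which start at a common vertex $u$ and end at a common vertex $v\neq u$, such that apart from $u$ and $v$ all vertices of these paths are pairwise distinct (i.e. the paths are internally vertex-disjoint $u$–$v$ paths). A signed graph is a pair $(G,\sigma)$ with $\sigma\colon E(G)\to\{\pm1\}$ a signature. An incidence is a pair $v\colon e$ with $v$ an endpoint of edge $e$; $I(G)$ is the set of incidences. For a positive integer $n$ let $M_n=\{0,\pm1,\dots,\pm k\}$ if $n=2k+1$ and $M_n=\{\pm1,\dots,\pm k\}$ if $n=2k$. An $n$-edge-coloring of $(G,\sigma)$ is a map $f\colon I(G)\to M_n$ with $f(u\colon uv)=-\sigma(uv)f(v\colon uv)$ for every edge $uv$, and $f(u\colon e_1)\neq f(u\colon e_2)$ whenever $e_1\neq e_2$ are both incident to $u$. The chromatic index $\chi'(G,\sigma)$ is the least positive integer $n$ for which an $n$-edge-coloring exists. A graph $G$ is of class $1^\pm$ if $\chi'(G,\sigma)=\Delta(G)$ for every signature $\sigma$ of $G$, where $\Delta(G)$ is the maximum degree. *)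

(* Defs.v *)
(* Finite simple graphs and signed edge colorings, in the Mathematical
   Components library. *)
From HB Require Import structures.
From mathcomp Require Import all_boot all_order all_algebra.

Set Implicit Arguments.
Unset Strict Implicit.
Unset Printing Implicit Defensive.

Import GRing.Theory.
Local Open Scope ring_scope.

Record sgraph := SGraph {
  vertex :> finType;
  adj : rel vertex;
  adj_sym : symmetric adj;
  adj_irrefl : irreflexive adj
}.

Definition edges (G : sgraph) : {set {set G}} :=
  [set [set xy.1; xy.2] | xy : G * G & adj xy.1 xy.2].

Definition connected_graph (G : sgraph) : Prop :=
  forall x y : G, connect (@adj G) x y.

Definition deg (G : sgraph) (x : G) : nat := #|[set y | adj x y]|.

Definition Delta (G : sgraph) : nat := \max_(x : G) deg x.

(* The path with vertex sequence x :: p is represented, as in path.v, by its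
   first vertex x and the sequence p of the others. *)
Definition is_path (G : sgraph) (u v : G) (p : seq G) : Prop :=
  [/\ path (@adj G) u p, last u p = v & uniq (u :: p)].

Definition path_edges (G : sgraph) (x : G) (p : seq G) : seq {set G} :=
  pairmap (fun y z : G => [set y; z]) x p.

(* Each path has at least one edge, because u != v. *)
Definition necklace (G : sgraph) : Prop :=
  connected_graph G /\
  exists (k : nat) (u v : G) (p : 'I_k -> seq G),
    [/\ (2 <= k)%N /\ u <> v,
        forall i, is_path u v (p i),
        forall A, A \in edges G -> exists! i, A \in path_edges u (p i) &
        forall i j, i <> j -> forall x,
          x \in u :: p i -> x \in u :: p j -> x = u \/ x = v].

Definition is_cycle_graph (G : sgraph) : Prop :=
  exists c : seq G,
    [/\ uniq c, (3 <= size c)%N, forall x, x \in c &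
        forall x y, adj x y <-> (y = next c x \/ x = next c y)].

(* Signatures and colorings are total functions whose values are relevant only
   on edges and on incidences (v, A), v \in A \in edges G, respectively. *)
Definition is_signature (G : sgraph) (sigma : {set G} -> int) : Prop :=
  forall A, A \in edges G -> sigma A = 1 \/ sigma A = -1.

Definition incident (G : sgraph) (v : G) (A : {set G}) : bool :=
  (A \in edges G) && (v \in A).

(* The integers of absolute value at most n./2, with 0 omitted when n is
   even. *)
Definition M (n : nat) : pred int :=
  fun x => (`|x|%N <= n./2)%N && (odd n || (x != 0)).

Definition is_edge_coloring (G : sgraph) (sigma : {set G} -> int) (n : nat)
    (f : G -> {set G} -> int) : Prop :=
  [/\ forall v A, incident v A -> f v A \in M n,
      forall u v, adj u v ->
        f u [set u; v] = - sigma [set u; v] * f v [set u; v] &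
      forall u A B, incident u A -> incident u B -> A <> B -> f u A <> f u B].

Definition edge_colorable (G : sgraph) (sigma : {set G} -> int) (n : nat) :
    Prop :=
  exists f : G -> {set G} -> int, is_edge_coloring sigma n f.

Definition is_chromatic_index (G : sgraph) (sigma : {set G} -> int) (n : nat) :
    Prop :=
  [/\ (0 < n)%N, edge_colorable sigma n &
      forall m, (0 < m)%N -> edge_colorable sigma m -> (n <= m)%N].

Definition class1pm (G : sgraph) : Prop :=
  forall sigma : {set G} -> int,
    is_signature sigma -> is_chromatic_index sigma (Delta G).

(* Main.v *)
Require Import Defs.
From mathcomp Require Import all_boot all_order all_algebra.
From mathcomp Require Import zify.

Set Implicit Arguments.
Unset Strict Implicit.
Unset Printing Implicit Defensive.

Import Order.TTheory GRing.Theory.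
Local Open Scope ring_scope.

(** A necklace with k = 2 is a cycle, so k >= 3, and it suffices to color G
    with M_k: the degrees at u give k <= Delta, and Delta colors are always
    necessary.  Let a and b be the colors of a u-v path at its two ends.  A
    path of length 1 forces b = - sigma a; a path of length 2 excludes only
    b = e a for a sign e; a longer path excludes nothing, since M_k has at
    least three elements.  At most one path has length 1.  Give that path (or
    any path if there is none) the color 1 at u and the appropriate color 1 or
    -1 at v, and distribute the other colors of M_k arbitrarily at u.  Each
    remaining path then excludes one color at v.  Such an assignment problem is
    solvable unless all paths exclude the same available color c; this would
    put M_k \ {1} inside {c, -c}, which is impossible for k >= 3: the set
    contains -1 and one of 0 and 2. *)

(** * Sequences: cyclic successors and an assignment problem *)

Lemma next_cat_cons (T : eqType) (s1 s2 : seq T) (x y : T) :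
  uniq (s1 ++ x :: y :: s2) -> next (s1 ++ x :: y :: s2) x = y.
Proof.
move=> Uc; rewrite -(next_rot (size s1) Uc) rot_size_cat /=.
by rewrite eqxx.
Qed.

(** Greedy choice for the first position. If some value [c] is forbidden at all later positions, it
    has to be spent now, which is allowed because [c] is not forbidden everywhere; otherwise any
    value other than [f] will do. *)
Lemma exists_avoiding_permutation (T : eqType) (fs ms : seq T) :
  uniq ms -> size fs = size ms ->
  (forall c, c \in ms -> ~~ all (pred1 c) fs) ->
  exists2 t, perm_eq t ms & all2 (fun x y => x != y) fs t.
Proof.
elim: fs ms => [|f fs IH] ms Ums Sz Hc.
  by exists [::] => //; move: Sz; case: ms {Ums Hc}.
suff [c cms [cf Hrest]] : exists2 c, c \in ms & c != f /\
    (forall d, d \in rem c ms -> ~~ all (pred1 d) fs).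
  have [|t pt At] := IH (rem c ms) (rem_uniq _ Ums) _ Hrest.
    by rewrite size_rem // -Sz.
  exists (c :: t); last by rewrite /= eq_sym cf.
  by rewrite perm_sym (perm_trans (perm_to_rem cms)) // perm_cons perm_sym.
case: (boolP (has (fun c => all (pred1 c) fs) ms)) => [/hasP[c cms Ac]|nH].
  exists c => //; split.
    by apply: contra (Hc c cms) => /eqP <-; rewrite /= eqxx.
  move=> d; rewrite mem_rem_uniq // => /andP[/= dc dms].
  (* With no later position [ms] is a singleton, so no [d] remains; otherwise the next forbidden
     value is [c], hence not [d]. *)
  case: fs Sz Ac {IH Hc} => [|g fs] /= Sz.
    case: ms Ums cms dms Sz => [|m [|]] //= _.
    by rewrite !inE => /eqP cm /eqP dm; rewrite cm dm eqxx in dc.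
  by case/andP=> /eqP-> _; rewrite eq_sym (negPf dc).
have Hd d : d \in ms -> ~~ all (pred1 d) fs.
  by move=> dms; apply: contra nH => ?; apply/hasP; exists d.
have [c cms cf] : exists2 c, c \in ms & c != f.
  case: ms Ums Sz Hc nH Hd => [|m [|m' ms]] //=.
    by move=> _ [/size0nil ->].
  rewrite inE negb_or => /andP[/andP[mm' _] _] _ _ _ _.
  case: (eqVneq m f) => [mf|]; last by exists m; rewrite ?inE ?eqxx.
  by exists m'; rewrite ?inE ?eqxx ?orbT // -mf eq_sym.
exists c => //; split=> // d /mem_rem; exact: Hd.
Qed.

(** * The color sets *)

Definition Mseq (n : nat) : seq int :=
  [seq Posz i | i <- iota 1 n./2] ++ [seq - Posz i | i <- iota 1 n./2]
  ++ nseq (odd n) 0.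

Lemma mem_Mseq n x : (x \in Mseq n) = (x \in M n).
Proof.
rewrite !mem_cat mem_nseq /in_mem /= /M.
apply/idP/idP.
  case/or3P => [/mapP[i]|/mapP[i]|/andP[]].
  - by rewrite mem_iota => ? ->; lia.
  - by rewrite mem_iota => ? ->; lia.
  - by case: (odd n) => // _ /eqP ->.
move=> /andP[le on]; apply/or3P.
case: (ltgtP x 0) => [x0|x0|x0].
- by constructor 2; apply/mapP; exists `|x|%N; rewrite ?mem_iota; lia.
- by constructor 1; apply/mapP; exists `|x|%N; rewrite ?mem_iota; lia.
- by constructor 3; move: on; rewrite x0 eqxx orbF => ->.
Qed.

(** With [Mseq_uniq], this is the cardinality of [M n] behind all counting arguments. *)
Lemma size_Mseq n : size (Mseq n) = n.
Proof. by rewrite !size_cat !size_map size_iota size_nseq; lia. Qed.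

Lemma Mseq_uniq n : uniq (Mseq n).
Proof.
rewrite !cat_uniq !map_inj_uniq ?iota_uniq //=; try by move=> i j; lia.
rewrite has_cat negb_or -!all_predC -andbA; apply/and4P; split.
- by apply/allP => x /mapP[i]; rewrite mem_iota => i1 -> /=; apply/negP => /mapP[j];
    rewrite mem_iota; lia.
- apply/allP => x; rewrite mem_nseq => /andP[_ /eqP->] /=.
  by apply/negP => /mapP[j]; rewrite mem_iota; lia.
- apply/allP => x; rewrite mem_nseq => /andP[_ /eqP->] /=.
  by apply/negP => /mapP[j]; rewrite mem_iota; lia.
- by case: (odd n).
Qed.

Lemma M_sign n s x : s = 1 \/ s = -1 -> x \in M n -> s * x \in M n.
Proof. by case=> ->; rewrite ?mul1r ?mulN1r // /in_mem /= /M; lia. Qed.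

Lemma M_opp n x : x \in M n -> - x \in M n.
Proof. by rewrite /in_mem /= /M; lia. Qed.

Lemma M_avoid2 n x y : (3 <= n)%N ->
  exists2 c, c \in M n & c <> x /\ c <> y.
Proof.
move=> n3.
have [c cM cxy] : exists2 c, c \in Mseq n & c \notin [:: x; y].
  apply/hasP; apply: contraT; rewrite -all_predC => /allP H.
  have /(uniq_leq_size (Mseq_uniq n)) : {subset Mseq n <= [:: x; y]}.
    by move=> c /H /=; rewrite negbK.
  by rewrite size_Mseq /=; lia.
exists c; first by rewrite -mem_Mseq.
by move: cxy; rewrite !inE negb_or => /andP[/eqP ? /eqP].
Qed.

(** * Edges along a path *)

Section PathEdges.
Variable G : sgraph.
Implicit Types (x y z : G) (p : seq G) (A : {set G}).

Lemma path_edges_vertex x p A z :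
  A \in path_edges x p -> z \in A -> z \in x :: p.
Proof.
elim: p x => [|y p IH] x //=; rewrite inE => /orP[/eqP->|/IH{}IH zA].
  by rewrite !inE => /orP[] -> //; rewrite orbT.
by rewrite inE IH ?orbT.
Qed.

Lemma set2_in_path_edges x p y z : [set y; z] \in path_edges x p ->
  exists s1 s2,
    x :: p = s1 ++ y :: z :: s2 \/ x :: p = s1 ++ z :: y :: s2.
Proof.
elim: p x => [|w p IH] x //=; rewrite inE => /orP[/eqP E|/IH[s1 [s2 H]]].
  exists [::], p => /=.
  have /set2P[yE|yE] : y \in [set x; w] by rewrite -E set21.
  - have /set2P[zE|zE] : z \in [set x; w] by rewrite -E set22.
    + by left; subst y z; move/setP/(_ w): E; rewrite !inE eqxx orbT orbb => /eqP->.
    + by left; subst.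
  - have /set2P[zE|zE] : z \in [set x; w] by rewrite -E set22.
    + by right; subst.
    + by left; subst y z; move/setP/(_ x): E; rewrite !inE eqxx orbb => /eqP->.
by exists (x :: s1), s2; case: H => ->; [left|right].
Qed.

Lemma path_edges_sub x p : path (@adj G) x p ->
  {subset path_edges x p <= edges G}.
Proof.
elim: p x => [|y p IH] x //= /andP[xy /IH{}IH] A.
rewrite inE => /orP[/eqP->|]; last exact: IH.
by apply/imsetP; exists (x, y) => //; rewrite inE.
Qed.

Lemma set2_edge x y : adj x y -> [set x; y] \in edges G.
Proof. by move=> xy; apply/imsetP; exists (x, y); rewrite ?inE. Qed.

End PathEdges.

(** * Coloring one path with prescribed end colors *)

Section PathColoring.
Variables (G : sgraph) (sigma : {set G} -> int) (n : nat).
Hypothesis sigmaP : is_signature sigma.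
Implicit Types (x y z : G) (p : seq G) (A B : {set G}).

(* [a] and [b] are the colors prescribed at the two ends of the path [x :: p]. *)
Definition path_colorable x p (a b : int) : Prop :=
  exists g : G -> {set G} -> int,
  [/\ forall A z, A \in path_edges x p -> z \in A -> g z A \in M n,
      forall z w, [set z; w] \in path_edges x p ->
        g z [set z; w] = - sigma [set z; w] * g w [set z; w],
      forall A B z, A \in path_edges x p -> B \in path_edges x p ->
        z \in A -> z \in B -> A <> B -> g z A <> g z B,
      forall A, A \in path_edges x p -> x \in A -> g x A = a &
      forall A, A \in path_edges x p -> last x p \in A -> g (last x p) A = b].

Lemma path_colorable1 x y a : adj x y -> a \in M n ->
  path_colorable x [:: y] a (- sigma [set x; y] * a).
Proof.
move=> xy aM; set s := sigma _.
have sP : s = 1 \/ s = -1 by apply/sigmaP/set2_edge.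
have yx : y == x = false by apply/eqP => E; move: xy; rewrite E adj_irrefl.
have saM : - s * a \in M n by rewrite mulNr; apply/M_opp/M_sign.
exists (fun z _ => if z == x then a else - s * a); split => /=.
- by move=> A z _ _; case: ifP.
- move=> z w; rewrite inE => /eqP E; rewrite E -/s.
  have nzw : z != w.
    apply/eqP => zw; move: E; rewrite zw setUid => /setP E.
    move: (E x) (E y); rewrite !inE !eqxx orbT /= => /eqP xw /eqP yw.
    by rewrite yw xw eqxx in yx.
  have /set2P[zE|zE] : z \in [set x; y] by rewrite -E set21.
    have /set2P[wE|wE] : w \in [set x; y] by rewrite -E set22.
      by rewrite zE wE eqxx in nzw.
    by subst; rewrite eqxx yx; case: sP => ->; lia.
  have /set2P[wE|wE] : w \in [set x; y] by rewrite -E set22.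
    by subst; rewrite eqxx yx.
  by rewrite zE wE eqxx in nzw.
- by move=> A B z; rewrite !inE => /eqP-> /eqP->.
- by move=> A _ _; rewrite eqxx.
- by move=> A _ _; rewrite yx.
Qed.

(** The new edge meets the rest of the path only in [y], where it has color [- sigma [set x; y] *
    a], so comparing this with [c] settles properness. As [p] is nonempty, the last vertex is off
    the new edge and keeps color [b]. *)
Lemma path_colorable_cons x y p a b c :
  adj x y -> uniq (x :: y :: p) -> (0 < size p)%N -> a \in M n ->
  c <> - sigma [set x; y] * a -> path_colorable y p c b ->
  path_colorable x (y :: p) a b.
Proof.
move=> xy; rewrite [uniq _]/= => /and3P[xp yp Up] p0 aM cs [g' [g1 g2 g3 g4 g5]].
have [g [h1 h2 h3 h4 h5]] := path_colorable1 xy aM.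
pose e := [set x; y].
have xN A : A \in path_edges y p -> x \notin A.
  by move=> Ap; apply: contra xp => /(path_edges_vertex Ap).
have eN : e \notin path_edges y p.
  by apply/negP => /xN; rewrite set21.
have lx : last x (y :: p) \notin e.
  case: p p0 xp yp {Up g1 g2 g3 g4 g5 xN eN} => //= z p _ xp yp.
  apply/negP => /set2P[] E.
    by move: xp; rewrite -E inE mem_last orbT.
  by move: yp; rewrite -E mem_last.
have AE A : A \in path_edges x (y :: p) ->
    (A = e /\ A \in path_edges x [:: y]) \/ (A != e /\ A \in path_edges y p).
  rewrite /= inE => /orP[/eqP->|Ap]; first by left; rewrite inE.
  by right; split=> //; apply: contraNneq eN => <-.
exists (fun z A => if A == e then g z A else g' z A); split.
- move=> A z /AE[[-> ee]|[/negPf-> Ap]]; last exact: g1.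
  by rewrite eqxx; apply: h1; rewrite inE.
- move=> z w /AE[[E ee]|[/negPf nA Ap]]; last by rewrite nA; apply: g2.
  by rewrite E eqxx -E; apply: h2.
- have H B z : B \in path_edges y p -> z \in e -> z \in B -> g z e <> g' z B.
    move=> Bp /set2P[->|->] zB; first by rewrite (negPf (xN _ Bp)) in zB.
    rewrite (g4 _ Bp zB) (h5 e) ?inE ?eqxx ?orbT //.
    exact/nesym.
  move=> A B z /AE[[-> ?]|[nA Ap]] /AE[[-> ?]|[nB Bp]] zA zB AB //.
  + by rewrite eqxx (negPf nB); apply: H.
  + by rewrite eqxx (negPf nA); apply/nesym/H.
  + by rewrite (negPf nA) (negPf nB); apply: g3.
- move=> A /AE[[-> ?]|[nA Ap]] xA; last by rewrite (negPf (xN _ Ap)) in xA.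
  by rewrite eqxx; apply: h4; rewrite // inE.
- move=> A /AE[[-> ?]|[nA Ap]] lA; first by rewrite (negPf lx) in lA.
  by rewrite (negPf nA); apply: g5.
Qed.

Lemma path_colorable_long x p : (3 <= n)%N ->
  path (@adj G) x p -> uniq (x :: p) -> (2 <= size p)%N ->
  exists2 e : int, e = 1 \/ e = -1 &
    forall a b, a \in M n -> b \in M n -> b <> e * a -> path_colorable x p a b.
Proof.
move=> n3; elim: p x => [|y [|z p] IH] x // /andP[xy pp] Up _.
have sP : sigma [set x; y] = 1 \/ sigma [set x; y] = -1.
  exact/sigmaP/set2_edge.
have Up' : uniq (y :: z :: p) by case/andP: Up.
case: p IH pp Up Up' => [|w p] IH pp Up Up'.
  case/andP: pp => yz _; set t := sigma [set y; z].
  have tP : t = 1 \/ t = -1 by exact/sigmaP/set2_edge.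
  (* On a path of length 2, the edges have colors [- sigma [set x; y] * a] and [- t * b] at [y];
     these agree exactly when [b] is this sign times [a]. *)
  exists (sigma [set x; y] * t); first by case: sP tP => -> [] ->; auto.
  move=> a b aM bM bE.
  apply: (@path_colorable_cons x y [:: z] a b (- t * b)) => //.
    by case: tP sP bE => -> [] ->; lia.
  have bE' : b = - t * (- t * b) by case: tP => ->; lia.
  rewrite [in X in path_colorable _ _ _ X]bE'; apply: path_colorable1 => //.
  by rewrite mulNr; apply/M_opp/M_sign.
have [e eP He] := IH y pp Up' isT.
(* The sign is arbitrary here: the color [c] at [y] can be chosen to avoid both the color of the
   first edge and the one value excluded by the rest of the path. *)
exists 1; first by left.
move=> a b aM bM _.
have [c cM [c1 c2]] := M_avoid2 (- sigma [set x; y] * a) (e * b) n3.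
apply: (path_colorable_cons xy Up _ aM c1) => //.
by apply: He => //; case: eP c2 => ->; lia.
Qed.

End PathColoring.

(** * The degree bound and the choice of end colors *)

Lemma Delta_le_edge_colorable (G : sgraph) (sigma : {set G} -> int) m :
  edge_colorable sigma m -> (Delta G <= m)%N.
Proof.
case=> f [f1 _ f3]; apply/bigmax_leqP => x _.
have inc y : adj x y -> incident x [set x; y].
  by move=> xy; rewrite /incident set2_edge ?set21.
(* The edges at [x] carry distinct elements of [M m], which has [m] elements. *)
rewrite /deg cardE -(size_map (fun y => f x [set x; y])) -[leqRHS]size_Mseq.
apply: uniq_leq_size.
  rewrite map_inj_in_uniq ?enum_uniq // => y z.
  rewrite !mem_enum !inE => xy xz E.
  case: (eqVneq [set x; y] [set x; z]) => [/setP S|/eqP S]; last first.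
    by case: (f3 x _ _ (inc _ xy) (inc _ xz) S E).
  have: y \in [set x; z] by rewrite -S set22.
  rewrite !inE => /orP[] /eqP // yx.
  by move: xy; rewrite yx adj_irrefl.
move=> c /mapP[y]; rewrite mem_enum inE => xy ->.
by rewrite mem_Mseq; apply/f1/inc.
Qed.

(** Here [a] runs through [Mseq k] with [i0] in first place, and [b] through [b0] followed by a
    permutation of the other colors from [exists_avoiding_permutation], the value forbidden at [i]
    being [e i * a i]. *)
Lemma exists_end_colors k (i0 : 'I_k) (e : 'I_k -> int) (b0 : int) :
  (3 <= k)%N -> (forall i, e i = 1 \/ e i = -1) -> b0 = 1 \/ b0 = -1 ->
  exists a b : 'I_k -> int,
  [/\ injective a, injective b, forall i, a i \in M k /\ b i \in M k,
      a i0 = 1 /\ b i0 = b0 & forall i, i <> i0 -> b i <> e i * a i].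
Proof.
move=> k3 eP b0P.
pose s := rem i0 (enum 'I_k); pose cs := behead (Mseq k).
(* The color 1 comes first in [Mseq k], which yields [a i0 = 1]. *)
have csE : Mseq k = 1 :: cs.
  by rewrite /cs /Mseq; case: k./2 (half_leq k3).
have i0s : perm_eq (i0 :: s) (enum 'I_k).
  by rewrite perm_sym; apply/perm_to_rem/mem_enum.
have Us : uniq (i0 :: s) by rewrite (perm_uniq i0s) enum_uniq.
have ms i : i \in i0 :: s by rewrite (perm_mem i0s) mem_enum.
have Ss : size (i0 :: s) = k by rewrite (perm_size i0s) size_enum_ord.
have Is i : (index i (i0 :: s) < k)%N by rewrite -[ltnRHS]Ss index_mem.
have nthI (c : seq int) : uniq c -> size c = k ->
    injective (fun i => nth 0 c (index i (i0 :: s))).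
  move=> Uc Sc i j /eqP.
  rewrite nth_uniq ?Sc // => /eqP E.
  by rewrite -(nth_index i0 (ms i)) E nth_index.
have Mb0 : b0 \in Mseq k.
  by rewrite mem_Mseq /in_mem /= /M; case: b0P => ->; lia.
pose a i := nth 0 (Mseq k) (index i (i0 :: s)).
have as_ : [seq a i | i <- s] = cs.
  have Sc : size cs = size s.
    by apply: succn_inj; rewrite -[RHS]/(size (i0 :: s)) Ss -[RHS]size_Mseq csE.
  apply: (@eq_from_nth _ 0); rewrite size_map // => j js.
  rewrite (nth_map i0) // /a csE.
  case/andP: (Us) => ns Us'.
  rewrite /= ifN ?index_uniq //.
  by apply: contra ns => /eqP->; apply: mem_nth.
have [||t pt At] := @exists_avoiding_permutation _ [seq e i * a i | i <- s]
    (rem b0 (Mseq k)) (rem_uniq _ (Mseq_uniq k)).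
- by rewrite size_rem // size_Mseq size_map -[in RHS]Ss.
- move=> c _; apply/negP => /allP H.
  have Hc x : x \in cs -> x = c \/ x = - c.
    rewrite -as_ => /mapP[i si ->].
    have /H/eqP : e i * a i \in [seq e i * a i | i <- s] by apply: map_f.
    by case: (eP i) => ->; lia.
  have N1 : -1 \in cs.
    have : -1 \in Mseq k by rewrite mem_Mseq /in_mem /= /M; lia.
    by rewrite csE inE.
  have [x xcs xP] : exists2 x, x \in cs & x = 0 \/ x = 2.
    have : (if odd k then 0 else 2 : int) \in Mseq k.
      by rewrite mem_Mseq /in_mem /= /M; case: ifP; lia.
    by rewrite csE inE; case: ifP => _ /= h; [exists 0|exists 2]; auto.
  (* The absolute value of [x] is 0 or 2, so [x] and -1 cannot both be [c] or [- c]. *)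
  by case: (Hc _ N1) (Hc _ xcs) xP; lia.
have pb : perm_eq (b0 :: t) (Mseq k).
  by rewrite (perm_trans _ (_ : perm_eq (b0 :: rem b0 (Mseq k)) _)) ?perm_cons //
    perm_sym perm_to_rem.
have Sb : size (b0 :: t) = k by rewrite (perm_size pb) size_Mseq.
exists a, (fun i => nth 0 (b0 :: t) (index i (i0 :: s))); split.
- by apply: nthI; rewrite ?Mseq_uniq ?size_Mseq.
- by apply: nthI; rewrite // (perm_uniq pb) Mseq_uniq.
- move=> i; rewrite -!mem_Mseq.
  by split; last rewrite -(perm_mem pb); apply: mem_nth; rewrite ?size_Mseq ?Sb.
- by rewrite /a csE /= eqxx.
- move=> i /eqP ii0; have si : i \in s.
    by move: (ms i); rewrite inE (negPf ii0).
  rewrite /= eq_sym (negPf ii0) /= => E.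
  move: At; rewrite all2E => /andP[/eqP Sz /(all_nthP (0, 0))].
  move/(_ (index i s)); rewrite size_zip -Sz minnn size_map index_mem nth_zip //=.
  by rewrite (nth_map i0) ?index_mem // nth_index // E eqxx => /(_ si).
Qed.

(** * Assembling the path colorings in a necklace *)

Section Necklace.
Variables (G : sgraph) (k : nat) (u v : G) (p : 'I_k -> seq G).
Hypothesis uv : u <> v.
Hypothesis pP : forall i, is_path u v (p i).
Hypothesis pE :
  forall A, A \in edges G -> exists! i, A \in path_edges u (p i).
Hypothesis pD : forall i j, i <> j -> forall x,
  x \in u :: p i -> x \in u :: p j -> x = u \/ x = v.

Lemma necklace_path_edge_inj i j A :
  A \in path_edges u (p i) -> A \in path_edges u (p j) -> i = j.
Proof.
have [pi _ _] := pP i.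
move=> Ai Aj; have [l [_ Hl]] := pE (path_edges_sub pi Ai).
by rewrite -(Hl i Ai) -(Hl j Aj).
Qed.

(** As [u <> v], [p i] is nonempty, so the default of [head] never occurs and [head v (p i)] is the
    neighbor of [u] on the path. *)
Lemma necklace_path_head i : head v (p i) \in p i.
Proof.
have [_ + _] := pP i; case: (p i) => [E|x q _] /=; first by case: uv.
by rewrite mem_head.
Qed.

Lemma necklace_path_head_edge i : [set u; head v (p i)] \in path_edges u (p i).
Proof.
by have := necklace_path_head i; case: (p i) => //= x q _; rewrite inE eqxx.
Qed.

(** The second vertices of the paths are neighbors of [u]; they are distinct because an edge at [u]
    lies on only one path. *)
Lemma necklace_size_le_Delta : (k <= Delta G)%N.
Proof.
apply: leq_trans (leq_bigmax u); rewrite /deg.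
rewrite -[k]card_ord -(card_imset (f := fun i => head v (p i)) predT).
  apply/subset_leq_card/subsetP => x /imsetP[i _ ->]; rewrite inE.
  have [+ _ _] := pP i; have := necklace_path_head i.
  by case: (p i) => //= y q _ /andP[].
move=> i j E; apply: (@necklace_path_edge_inj i j [set u; head v (p i)]).
  exact: necklace_path_head_edge.
rewrite E; exact: necklace_path_head_edge.
Qed.

Lemma necklace_short_path i : (size (p i) <= 1)%N -> p i = [:: v].
Proof.
have [_ + _] := pP i; case: (p i) => [E|x [|]] //=.
by move=> ->.
Qed.

(** Both paths would consist of the single edge from [u] to [v], which belongs to only one path. *)
Lemma necklace_short_path_inj i j :
  (size (p i) <= 1)%N -> (size (p j) <= 1)%N -> i = j.
Proof.
move=> /necklace_short_path Ei /necklace_short_path Ej.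
by apply: (@necklace_path_edge_inj i j [set u; v]);
  rewrite ?Ei ?Ej /= inE eqxx.
Qed.

Lemma necklace_edge_colorable (sigma : {set G} -> int) :
  is_signature sigma -> (3 <= k)%N -> edge_colorable sigma k.
Proof.
move=> sP k3.
have /fin_all_exists[e eP] : forall i, exists e : int, (e = 1 \/ e = -1) /\
    ((1 < size (p i))%N -> forall a b, a \in M k -> b \in M k -> b <> e * a ->
      path_colorable sigma k u (p i) a b).
  move=> i; have [pi _ Ui] := pP i.
  case: (leqP (size (p i)) 1) => [_|Si]; first by exists 1; split; [left|].
  by have [e eP He] := path_colorable_long sP k3 pi Ui Si; exists e.
have [i0 Hi0] : exists i0, forall i, i <> i0 -> (1 < size (p i))%N.
  case: (pickP (fun i => size (p i) <= 1)%N) => [i0 S0|S].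
    exists i0 => i ii0; rewrite ltnNge; apply/negP => Si.
    exact/ii0/necklace_short_path_inj.
  by exists (Ordinal (leq_trans (isT : (0 < 3)%N) k3)) => i _; rewrite ltnNge S.
have M1 : 1 \in M k by rewrite /in_mem /= /M; lia.
have MN1 : -1 \in M k by rewrite /in_mem /= /M; lia.
have [b0 b0P Hb0] : exists2 b0 : int, b0 = 1 \/ b0 = -1 &
    path_colorable sigma k u (p i0) 1 b0.
  case: (leqP (size (p i0)) 1) => [/necklace_short_path S0|S0].
    have auv : adj u v by have [+ _ _] := pP i0; rewrite S0 /= andbT.
    exists (- sigma [set u; v] * 1); last first.
      by rewrite S0; apply: path_colorable1.
    by case: (sP _ (set2_edge auv)) => ->; [right|left].
  have [e0 /(_ S0) He] := eP i0.
  (* With color 1 at [u], the color [e i0] is to be avoided at [v]; its opposite is a safe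
     choice. *)
  exists (- e i0); first by case: e0 => ->; [right|left].
  by apply: He => //; case: e0 => ->.
have [a [b [aI bI abM [a0 b0E] Hab]]] := exists_end_colors i0 k3 (fun i => (eP i).1) b0P.
have /fin_all_exists[g gP] : forall i, path_colorable sigma k u (p i) (a i) (b i).
  move=> i; case: (eqVneq i i0) => [->|/eqP ii0]; first by rewrite a0 b0E.
  by case: (abM i) => aM bM; apply: (eP i).2 => //; [apply: Hi0|apply: Hab].
(* Each edge takes its colors from the unique path through it; 0 is a placeholder off the edges. *)
pose f x A := if [pick i | A \in path_edges u (p i)] is Some i then g i x A else 0.
have fE i A x : A \in path_edges u (p i) -> f x A = g i x A.
  move=> Ai; rewrite /f; case: pickP => [j Aj|/(_ i)]; last by rewrite Ai.
  by rewrite (necklace_path_edge_inj Aj Ai).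
exists f; split.
- move=> x A /andP[/pE[i [Ai _]] xA]; rewrite (fE i) //.
  by have [+ _ _ _ _] := gP i; apply.
- move=> x y /set2_edge/pE[i [Ai _]]; rewrite !(fE i) //.
  by have [_ + _ _ _] := gP i; apply.
- move=> x A B /andP[/pE[i [Ai _]] xA] /andP[/pE[j [Bj _]] xB] AB.
  rewrite (fE i) // (fE j) //.
  have [_ _ g3 g4 g5] := gP i; have [_ _ _ h4 h5] := gP j.
  case: (eqVneq i j) => [ij|/eqP ij]; first by subst j; apply: g3.
  have lv l : last u (p l) = v by case: (pP l).
  (* Edges of different paths meet only at [u] or [v], where injectivity of [a] or [b] separates
     their colors. *)
  case: (pD ij (path_edges_vertex Ai xA) (path_edges_vertex Bj xB)) => xE; subst x.
    by rewrite g4 // h4 // => /aI.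
  by move: g5 h5; rewrite !lv => g5 h5; rewrite g5 // h5 // => /bI.
Qed.

(** By connectivity and [u <> v] no vertex is isolated, and the path through an edge at [x] contains
    [x]. *)
Lemma necklace_vertex_covered : connected_graph G ->
  forall x, exists i, x \in u :: p i.
Proof.
move=> cG x.
have [y xy] : exists y, adj x y.
  have [w xw] : exists w, x <> w.
    by case: (eqVneq x u) => [->|/eqP]; [exists v|exists u].
  have /connectP[[|y q] /= + wE] := cG x w; first by rewrite wE in xw.
  by case/andP=> xy _; exists y.
have [i [Ai _]] := pE (set2_edge xy).
by exists i; apply: path_edges_vertex Ai _; rewrite set21.
Qed.

End Necklace.

(** The cycle runs from [u] to [v] along one path and returns along the reverse of the other. *)
Lemma necklace2_cycle (G : sgraph) (u v : G) (p : 'I_2 -> seq G) :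
  connected_graph G -> u <> v -> (forall i, is_path u v (p i)) ->
  (forall A, A \in edges G -> exists! i, A \in path_edges u (p i)) ->
  (forall i j, i <> j -> forall x,
     x \in u :: p i -> x \in u :: p j -> x = u \/ x = v) ->
  is_cycle_graph G.
Proof.
move=> cG uv pP pE pD.
have i01 : (ord0 : 'I_2) <> ord_max by [].
have iE (i : 'I_2) : i = ord0 \/ i = ord_max.
  by case: i => [[|[|]]] // ?; [left|right]; apply: val_inj.
have cov := necklace_vertex_covered uv pE cG.
have short := necklace_short_path_inj uv pP pE.
have rconsE i : exists q, p i = rcons q v.
  have [_ + _] := pP i; case/lastP: (p i) => [|q y] /=; first by move/uv.
  by rewrite last_rcons => ->; exists q.
have [r rE] := rconsE ord0; have [q qE] := rconsE ord_max.
have [path0 _ U0] := pP ord0; have [path1 _ U1] := pP ord_max.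
rewrite rE in path0 U0; rewrite qE in path1 U1.
pose c := (u :: rcons r v) ++ rev q.
(* Rotating [c] to start at [v] displays the whole reversed second path, so that the closing edge
   into [u] also joins consecutive entries. *)
have rotc : rot (size r).+1 c = rev (u :: rcons q v) ++ r.
  rewrite /c cat_cons cat_rcons -cat_cons -[(size r).+1]/(size (u :: r)).
  by rewrite rot_size_cat rev_cons rev_rcons /= cat_rcons.
have Uc : uniq c.
  rewrite /c cat_uniq U0 rev_uniq.
  move: U1; rewrite /= rcons_uniq mem_rcons inE negb_or => /and3P[/andP[_ uq] vq ->].
  rewrite andbT -all_predC; apply/allP => x; rewrite mem_rev => xq /=.
  apply/negP => x0; have := pD _ _ i01 x; rewrite rE qE => /(_ x0).
  rewrite inE mem_rcons inE xq !orbT => /(_ isT)[] xE; subst x.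
    by rewrite xq in uq.
  by rewrite xq in vq.
have adjC : cycle (@adj G) c.
  rewrite /c /= rcons_cat cat_path path0 last_rcons /=.
  have := rev_path (@adj G) u (rcons q v).
  rewrite last_rcons belast_rcons rev_cons => ->.
  by rewrite (eq_path (e' := @adj G)) // => x y; rewrite adj_sym.
have Sc : (3 <= size c)%N.
  rewrite /c size_cat /= size_rcons size_rev.
  case: r q rE qE {path0 path1 U0 U1 rotc Uc adjC c} => [|? ?] [|? ?] //= E0 E1.
  (* Only [r] and [q] both empty would make [c] too short, and then both paths would have length
     1. *)
  by case: i01; apply: short; rewrite ?E0 ?E1.
have memc x : x \in c.
  rewrite /c mem_cat mem_rev.
  have [i] := cov x; case: (iE i) => ->; first by rewrite rE => ->.
  rewrite qE.
  by rewrite !inE !mem_rcons !inE => /or3P[] ->; rewrite ?orbT.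
exists c; split=> // x y; split; last first.
  by case=> ->; [|rewrite adj_sym]; apply: (next_cycle adjC).
have nextc s1 s2 z w : u :: rcons r v = s1 ++ z :: w :: s2 \/
    rev (u :: rcons q v) = s1 ++ z :: w :: s2 -> next c z = w.
  case=> E.
    by move: Uc; rewrite /c E -catA; apply: next_cat_cons.
  rewrite -(next_rot (size r).+1 Uc).
  move: Uc; rewrite -(rot_uniq (size r).+1) rotc E -catA.
  exact: next_cat_cons.
move=> /set2_edge/pE[i [Ai _]].
have [s1 [s2]] := set2_in_path_edges Ai.
have revE z w : u :: rcons q v = s1 ++ z :: w :: s2 ->
    rev (u :: rcons q v) = rev s2 ++ w :: z :: rev s1.
  by move=> ->; rewrite rev_cat !rev_cons -!cats1 -!catA.
(* The edge lies on one of the two paths, in one of two directions; [c] traverses the second path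
   backwards. *)
case: (iE i) => ->; rewrite ?rE ?qE => -[] E.
- by left; rewrite (nextc s1 s2 x y); auto.
- by right; rewrite (nextc s1 s2 y x); auto.
- by right; rewrite (nextc (rev s2) (rev s1) y x); auto.
- by left; rewrite (nextc (rev s2) (rev s1) x y); auto.
Qed.

Theorem theorem6 (G : sgraph) : necklace G -> ~ is_cycle_graph G -> class1pm G.
Proof.
move=> [cG [k [u [v [p [[k2 uv] pP pE pD]]]]]] nC sigma sP.
have k3 : (3 <= k)%N.
  case: k k2 p pP pE pD => [|[|[|k]]] // _ p pP pE pD.
  by case: nC; exact: (necklace2_cycle cG uv pP pE pD).
have colk := necklace_edge_colorable uv pP pE pD sP k3.
(* The coloring with [k] colors gives one inequality, the degree of [u] the other. *)
have -> : Delta G = k.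
  apply/eqP; rewrite eqn_leq (Delta_le_edge_colorable colk).
  exact: (necklace_size_le_Delta uv pP pE).
split=> // [|m _ colm]; first exact: leq_trans k3.
apply: leq_trans (Delta_le_edge_colorable colm).
exact: (necklace_size_le_Delta uv pP pE).
Qed.
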